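(* The timed language inclusion problem for timed automata (given two TAs $\mathcal{A}$ and $\mathcal{B}$, decide whether $\mathrm{Tr}(\mathcal{A})\subseteq\mathrm{Tr}(\mathcal{B})$) and the weak opacity decision problem for timed automata are inter-reducible, i.e., each (many-one) reduces to the other.
   Context: A timed automaton (TA) is a tuple $\mathcal{A}=(\Sigma,L,\ell_0,L_{priv},L_f,X,I,E)$ where $\Sigma$ is a finite set of actions, $L$ a finite set of locations, $\ell_0\in L$ the initial location, $L_{priv}\subseteq L$ the set of private locations, $L_f\subseteq L$ the set of final locations, $X$ a finite set of clocks, $I$ assigns to each location an invariant, and $E$ is a finite set of edges $(\ell,g,a,R,\ell')$ with $\ell,\ell'\in L$, $a\in\Sigma\cup\{\varepsilon\}$ (where $\varepsilon$ is an unobservable action), $R\subseteq X$ the set of clocks to reset, and $g$ a guard. Invariants and guards are conjunctions of constraints $x\bowtie d$ with $x\in X$, $d\in\mathbb{Z}$, ${\bowtie}\in\{<,\le,=,\ge,>\}$. A clock valuation is a map $\mu:X\to\mathbb{R}_{\ge0}$; a configuration is a pair $(\ell,\mu)$ with $\mu\models I(\ell)$; the initial configuration is $(\ell_0,\mathbf{0})$. A delay $d\ge0$ leads from $(\ell,\mu)$ to $(\ell,\mu+d)$ provided $\mu+d'\models I(\ell)$ for all $d'\in[0,d]$; an edge $(\ell,g,a,R,\ell')$ leads from $(\ell,\mu)$ to $(\ell',\mu')$ if $\mu\models g$, $\mu'$ is $\mu$ with the clocks of $R$ set to $0$, and $\mu'\models I(\ell')$. A run is a finite sequence $(\ell_0,\mu_0),(d_0,e_0),(\ell_1,\mu_1),\dots,(\ell_n,\mu_n)$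 starting in the initial configuration, where each step is a delay $d_i$ followed by taking edge $e_i$, with $\ell_n\in L_f$ and $\ell_i\notin L_f$ for $i<n$. A timed word is a finite sequence of pairs $(a,t)\in\Sigma\times\mathbb{R}_{\ge0}$ with non-decreasing timestamps. The trace of a run is the timed word consisting, in order, of the pairs $(a_i,\sum_{j\le i}d_j)$ for the edges $e_i$ whose action $a_i$ is not $\varepsilon$. $\mathrm{Tr}(\mathcal{A})$ is the set of traces of all runs of $\mathcal{A}$ (its timed language). A run is private if it visits some location of $L_{priv}$ and public otherwise; $\mathrm{PrivTr}(\mathcal{A})$ and $\mathrm{PubTr}(\mathcal{A})$ denote the sets of traces of private, resp. public, runs. $\mathcal{A}$ is weakly opaque if $\mathrm{PrivTr}(\mathcal{A})\subseteq\mathrm{PubTr}(\mathcal{A})$; the weak opacity decision problem asks, given a TA, whether it is weakly opaque. *)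

(* Defs.v *)
From HB Require Import structures.
From mathcomp Require Import all_boot all_order all_algebra.
From mathcomp Require Import boolp classical_sets reals.

Set Implicit Arguments.
Unset Strict Implicit.
Unset Printing Implicit Defensive.

Import Order.TTheory GRing.Theory Num.Theory.

(** * Timed automata *)

(* Actions, locations and clocks are named by natural numbers, and finite sets
   are given by lists, so that an automaton is a finite object which can be the
   input of an algorithm. *)

Inductive cmp := CmpLt | CmpLe | CmpEq | CmpGe | CmpGt.

Definition nat_of_cmp (c : cmp) : nat :=
  match c with CmpLt => 0 | CmpLe => 1 | CmpEq => 2 | CmpGe => 3 | CmpGt => 4 end.

Definition cmp_of_nat (n : nat) : cmp :=
  match n with 0 => CmpLt | 1 => CmpLe | 2 => CmpEq | 3 => CmpGe | _ => CmpGt end.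

Lemma nat_of_cmpK : cancel nat_of_cmp cmp_of_nat.
Proof. by case. Qed.

HB.instance Definition _ := Equality.copy cmp (can_type nat_of_cmpK).

(* The triple (x, op, d) is the constraint "x op d". *)
Definition constr : Type := (nat * cmp * int)%type.

Definition constr_clock (c : constr) : nat := c.1.1.

(* A conjunction of constraints; the empty list is "true". *)
Definition guard : Type := seq constr.

Record edge := Edge {
  edge_src : nat;
  edge_guard : guard;
  edge_label : option nat;  (* None is the unobservable action epsilon *)
  edge_reset : seq nat;
  edge_tgt : nat }.

Definition tuple_of_edge (e : edge) :=
  (edge_src e, edge_guard e, edge_label e, edge_reset e, edge_tgt e).

Definition edge_of_tuple (t : nat * seq (nat * cmp * int) * option nat * seq nat * nat) :=
  let: (l, g, a, r, l') := t in Edge l g a r l'.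

Lemma tuple_of_edgeK : cancel tuple_of_edge edge_of_tuple.
Proof. by case. Qed.

HB.instance Definition _ := Equality.copy edge (can_type tuple_of_edgeK).

Record ta_data := TAData {
  ta_actions : seq nat;
  ta_locs : seq nat;
  ta_init : nat;
  ta_priv : seq nat;
  ta_final : seq nat;
  ta_clocks : seq nat;
  ta_invs : seq guard;      (* the i-th guard is the invariant of the i-th location *)
  ta_edges : seq edge }.

Definition guard_wf (X : seq nat) (g : guard) : bool :=
  all (fun c => constr_clock c \in X) g.

Definition edge_wf (A : ta_data) (e : edge) : bool :=
  [&& edge_src e \in ta_locs A,
      edge_tgt e \in ta_locs A,
      guard_wf (ta_clocks A) (edge_guard e),
      all (mem (ta_clocks A)) (edge_reset e) &
      if edge_label e is Some a then a \in ta_actions A else true].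

Definition ta_wf (A : ta_data) : bool :=
  [&& uniq (ta_locs A),
      ta_init A \in ta_locs A,
      all (mem (ta_locs A)) (ta_priv A),
      all (mem (ta_locs A)) (ta_final A),
      size (ta_invs A) == size (ta_locs A),
      all (guard_wf (ta_clocks A)) (ta_invs A) &
      all (edge_wf A) (ta_edges A)].

Record timed_automaton := TimedAutomaton {
  ta_of :> ta_data;
  ta_ofP : ta_wf ta_of }.

Definition ta_inv (A : timed_automaton) (l : nat) : guard :=
  nth [::] (ta_invs A) (index l (ta_locs A)).

(** * Semantics *)

Section Semantics.
Local Open Scope ring_scope.
Local Open Scope classical_set_scope.
Variable R : realType.

Definition cmp_sem (op : cmp) (x y : R) : bool :=
  match op with
  | CmpLt => x < y
  | CmpLe => x <= y
  | CmpEq => x == y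
  | CmpGe => y <= x
  | CmpGt => y < x
  end.

(* Only the values at the clocks of the automaton under consideration matter.
   Values are nonnegative in every run: clocks start at 0, delays are
   nonnegative and resets set clocks to 0. *)
Definition valuation : Type := nat -> R.

Definition val_shift (mu : valuation) (d : R) : valuation := fun x => mu x + d.

Definition val_reset (mu : valuation) (r : seq nat) : valuation :=
  fun x => if x \in r then 0 else mu x.

Definition sat (mu : valuation) (g : guard) : bool :=
  all (fun c : constr => let: (x, op, d) := c in cmp_sem op (mu x) d%:~R) g.

Definition config : Type := (nat * valuation)%type.

Definition delay_ok (A : timed_automaton) (c : config) (d : R) : Prop :=
  0 <= d /\ forall d', 0 <= d' <= d -> sat (val_shift c.2 d') (ta_inv A c.1).

Definition edge_step (A : timed_automaton) (c : config) (e : edge) (c' : config)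
    : Prop :=
  [/\ e \in ta_edges A, edge_src e = c.1 & edge_tgt e = c'.1] /\
  [/\ sat c.2 (edge_guard e),
      c'.2 =1 val_reset c.2 (edge_reset e) &
      sat c'.2 (ta_inv A c'.1)].

(* The triple (d, e, c') is the delay, the edge and the configuration reached.
   The first configuration of a run, being the initial one, is left implicit. *)
Definition run_step : Type := (R * edge * config)%type.

Fixpoint is_path (A : timed_automaton) (c : config) (r : seq run_step) : Prop :=
  match r with
  | [::] => True
  | (d, e, c') :: r' =>
      [/\ delay_ok A c d,
          edge_step A (c.1, val_shift c.2 d) e c' &
          is_path A c' r']
  end.

(* The locations visited after the initial one. *)
Definition run_locs (r : seq run_step) : seq nat := [seq s.2.1 | s <- r].

Definition is_run (A : timed_automaton) (r : seq run_step) : Prop :=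
  [/\ sat (fun _ => 0) (ta_inv A (ta_init A)),
      is_path A (ta_init A, fun _ => 0) r,
      last (ta_init A) (run_locs r) \in ta_final A &
      all (fun l => l \notin ta_final A) (belast (ta_init A) (run_locs r))].

Definition timed_word : Type := seq (nat * R).

Fixpoint trace_from (t : R) (r : seq run_step) : timed_word :=
  match r with
  | [::] => [::]
  | (d, e, _) :: r' =>
      if edge_label e is Some a then (a, t + d) :: trace_from (t + d) r'
      else trace_from (t + d) r'
  end.

Definition trace (r : seq run_step) : timed_word := trace_from 0 r.

Definition is_private (A : timed_automaton) (r : seq run_step) : bool :=
  has (mem (ta_priv A)) (ta_init A :: run_locs r).

Definition Tr (A : timed_automaton) : set timed_word :=
  [set w | exists2 r, is_run A r & trace r = w].

Definition PrivTr (A : timed_automaton) : set timed_word :=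
  [set w | exists r, [/\ is_run A r, is_private A r & trace r = w]].

Definition PubTr (A : timed_automaton) : set timed_word :=
  [set w | exists r, [/\ is_run A r, ~~ is_private A r & trace r = w]].

Definition weakly_opaque (A : timed_automaton) : Prop := PrivTr A `<=` PubTr A.

End Semantics.

(** * Computability *)

(* The model of computation is the WHILE language of N. D. Jones ("Computability
   and Complexity from a Programming Perspective", 1997): imperative programs
   over binary trees, a Turing-complete formalism. *)

Inductive tree := Nil | Cons of tree & tree.

Fixpoint tree_eqb (t u : tree) : bool :=
  match t, u with
  | Nil, Nil => true
  | Cons t1 t2, Cons u1 u2 => tree_eqb t1 u1 && tree_eqb t2 u2
  | _, _ => false
  end.

Inductive expr :=
  | EVar of nat
  | ENil
  | ECons of expr & expr
  | EHd of expr
  | ETl of expr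
  | EEq of expr & expr.

Inductive cmd :=
  | Assign of nat & expr
  | Seq of cmd & cmd
  | While of expr & cmd.

Definition store : Type := nat -> tree.

Definition upd (s : store) (x : nat) (t : tree) : store :=
  fun y => if y == x then t else s y.

Fixpoint eval (s : store) (e : expr) : tree :=
  match e with
  | EVar x => s x
  | ENil => Nil
  | ECons e1 e2 => Cons (eval s e1) (eval s e2)
  | EHd e1 => if eval s e1 is Cons t _ then t else Nil
  | ETl e1 => if eval s e1 is Cons _ t then t else Nil
  | EEq e1 e2 => if tree_eqb (eval s e1) (eval s e2) then Cons Nil Nil else Nil
  end.

(* In a loop test, Nil is false and every other tree is true. *)
Inductive exec : cmd -> store -> store -> Prop :=
  | ExecAssign s x e : exec (Assign x e) s (upd s x (eval s e))
  | ExecSeq s1 s2 s3 c1 c2 :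
      exec c1 s1 s2 -> exec c2 s2 s3 -> exec (Seq c1 c2) s1 s3
  | ExecWhileFalse s e c : eval s e = Nil -> exec (While e c) s s
  | ExecWhileTrue s1 s2 s3 e c :
      eval s1 e <> Nil -> exec c s1 s2 -> exec (While e c) s2 s3 ->
      exec (While e c) s1 s3.

(* "read x; c; write y" *)
Record program := Program {
  prog_in : nat;
  prog_body : cmd;
  prog_out : nat }.

Definition computes (p : program) (t u : tree) : Prop :=
  exists2 s, exec (prog_body p) (upd (fun _ => Nil) (prog_in p) t) s &
             s (prog_out p) = u.

(** * Decision problems and many-one reductions *)

Record decision_problem := DecisionProblem {
  instance : Type;
  encode : instance -> tree;
  encode_inj : injective encode;
  yes : instance -> Prop }.

Definition computable (P Q : decision_problem) (f : instance P -> instance Q)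
    : Prop :=
  exists p : program, forall x, computes p (encode x) (encode (f x)).

Definition many_one_reduces (P Q : decision_problem) : Prop :=
  exists f : instance P -> instance Q,
    computable f /\ forall x, yes x <-> yes (f x).

(** * Encoding of timed automata *)

Definition enc_nat (n : nat) : tree := iter n (Cons Nil) Nil.

Definition enc_int (z : int) : tree :=
  match z with
  | Posz n => Cons Nil (enc_nat n)
  | Negz n => Cons (Cons Nil Nil) (enc_nat n)
  end.

Definition enc_option T (enc : T -> tree) (o : option T) : tree :=
  if o is Some x then Cons Nil (enc x) else Nil.

Definition enc_seq T (enc : T -> tree) (s : seq T) : tree :=
  foldr (fun x t => Cons (enc x) t) Nil s.

Definition enc_pair S T (encS : S -> tree) (encT : T -> tree) (x : S * T) : tree :=
  Cons (encS x.1) (encT x.2).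

Definition enc_constr (c : constr) : tree :=
  let: (x, op, d) := c in
  Cons (enc_nat x) (Cons (enc_nat (nat_of_cmp op)) (enc_int d)).

Definition enc_guard : guard -> tree := enc_seq enc_constr.

Definition enc_edge (e : edge) : tree :=
  Cons (enc_nat (edge_src e))
    (Cons (enc_guard (edge_guard e))
      (Cons (enc_option enc_nat (edge_label e))
        (Cons (enc_seq enc_nat (edge_reset e))
          (enc_nat (edge_tgt e))))).

Definition enc_ta (A : timed_automaton) : tree :=
  Cons (enc_seq enc_nat (ta_actions A))
    (Cons (enc_seq enc_nat (ta_locs A))
      (Cons (enc_nat (ta_init A))
        (Cons (enc_seq enc_nat (ta_priv A))
          (Cons (enc_seq enc_nat (ta_final A))
            (Cons (enc_seq enc_nat (ta_clocks A))
              (Cons (enc_seq enc_guard (ta_invs A))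
                (enc_seq enc_edge (ta_edges A)))))))).

Lemma enc_nat_inj : injective enc_nat.
Proof. by elim=> [|m IHm] [|n] //= [] /IHm ->. Qed.

Lemma enc_int_inj : injective enc_int.
Proof. by case=> m [] n //= [] /enc_nat_inj ->. Qed.

Lemma enc_option_inj T (enc : T -> tree) :
  injective enc -> injective (enc_option enc).
Proof. by move=> encI [x|] [y|] //= [] /encI ->. Qed.

Lemma enc_seq_inj T (enc : T -> tree) : injective enc -> injective (enc_seq enc).
Proof. by move=> encI; elim=> [|x s IHs] [|y t] //= [] /encI -> /IHs ->. Qed.

Lemma enc_pair_inj S T (encS : S -> tree) (encT : T -> tree) :
  injective encS -> injective encT -> injective (enc_pair encS encT).
Proof. by move=> encSI encTI [x y] [x' y'] [] /encSI /= -> /encTI /= ->. Qed.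

Lemma enc_constr_inj : injective enc_constr.
Proof.
move=> [[x op] d] [[x' op'] d'] [] /enc_nat_inj ->.
by move=> /enc_nat_inj /(can_inj nat_of_cmpK) -> /enc_int_inj ->.
Qed.

Lemma enc_guard_inj : injective enc_guard.
Proof. exact/enc_seq_inj/enc_constr_inj. Qed.

Lemma enc_edge_inj : injective enc_edge.
Proof.
move=> [l g a r l'] [l1 g1 a1 r1 l1'] [] /enc_nat_inj /= -> /enc_guard_inj ->.
move=> /(enc_option_inj enc_nat_inj) -> /(enc_seq_inj enc_nat_inj) ->.
by move=> /enc_nat_inj ->.
Qed.

Lemma enc_ta_inj : injective enc_ta.
Proof.
have natsI := enc_seq_inj enc_nat_inj.
move=> [[S L l0 P F X I E] wfA] [[S' L' l0' P' F' X' I' E'] wfB] [].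
move=> /natsI eS /natsI eL /enc_nat_inj el0 /natsI eP /natsI eF /natsI eX.
move=> /(enc_seq_inj enc_guard_inj) eI /(enc_seq_inj enc_edge_inj) eE.
move: wfA wfB; rewrite /= in eS eL el0 eP eF eX eI eE.
rewrite eS eL el0 eP eF eX eI eE => wfA wfB.
by congr TimedAutomaton; exact: bool_irrelevance.
Qed.

Definition timed_language_inclusion (R : realType) : decision_problem :=
  DecisionProblem (enc_pair_inj enc_ta_inj enc_ta_inj)
    (fun AB => (@Tr R AB.1 `<=` @Tr R AB.2)%classic).

Definition weak_opacity (R : realType) : decision_problem :=
  DecisionProblem enc_ta_inj (weakly_opaque R).

(* Main.v *)
(** Opacity to inclusion: since every trace is private or public, [A] is weakly
    opaque iff [Tr A] is included in [PubTr A], and [PubTr A] is the language of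
    [A] with unsatisfiable invariants on the private locations.  Inclusion to
    opacity: in the disjoint union of [A] and [B], entered from a fresh initial
    location by instantaneous silent edges, and whose only private location is
    the initial location of [A], the private traces are those of [A] and the
    public ones those of [B].  Both maps are computable because the tree
    functions computed by WHILE programs are closed under composition, pairing
    and folds over lists. *)

From mathcomp Require Import all_boot all_order all_algebra.
From mathcomp Require Import boolp classical_sets reals.
Require Import Defs.

Set Implicit Arguments.
Unset Strict Implicit.
Unset Printing Implicit Defensive.

Import Order.TTheory GRing.Theory Num.Theory.

(** * Computable functions on trees *)

(* Variable [0] holds the input and the output, and the variables from [n] on
   are left untouched, so that they can store values across calls. *)
Definition tree_computable (f : tree -> tree) : Prop :=
  exists c n, forall s, exists2 s', exec c s s' &
    s' 0 = f (s 0) /\ forall y, n <= y -> s' y = s y.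

Definition hd (t : tree) : tree := if t is Cons u _ then u else Nil.
Definition tl (t : tree) : tree := if t is Cons _ u then u else Nil.

Definition enc_bool (b : bool) : tree := if b then Cons Nil Nil else Nil.

(** A tree is read as the list of heads along its right spine. The fold goes from the left, like a
    loop that consumes the list while updating an accumulator. *)
Fixpoint tfold (f : tree -> tree -> tree) (l acc : tree) : tree :=
  if l is Cons x l' then tfold f l' (f x acc) else acc.

Lemma tree_computable_expr (f : tree -> tree) (e : expr) :
  (forall s, eval s e = f (s 0)) -> tree_computable f.
Proof.
move=> ef; exists (Assign 0 e), 1 => s.
exists (upd s 0 (eval s e)); first exact: ExecAssign.
by split=> [|[]]; rewrite /upd ?eqxx /=.
Qed.

Lemma tree_computable_id : tree_computable id.
Proof. exact: (tree_computable_expr (e := EVar 0)). Qed.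

Lemma tree_computable_const (u : tree) : tree_computable (fun=> u).
Proof.
pose fix e t := if t is Cons t1 t2 then ECons (e t1) (e t2) else ENil.
apply: (tree_computable_expr (e := e u)) => s.
by elim: u => //= u1 -> u2 ->.
Qed.

Lemma tree_computable_comp (f g : tree -> tree) :
  tree_computable f -> tree_computable g -> tree_computable (fun t => f (g t)).
Proof.
move=> [cf [nf Hf]] [cg [ng Hg]]; exists (Seq cg cf), (maxn nf ng) => s.
have [s1 e1 [s1E s1P]] := Hg s; have [s2 e2 [s2E s2P]] := Hf s1.
exists s2; first exact: ExecSeq e1 e2.
by rewrite s2E s1E; split=> // y; rewrite geq_max => /andP[? ?]; rewrite s2P ?s1P.
Qed.

Lemma tree_computable_hd (f : tree -> tree) :
  tree_computable f -> tree_computable (fun t => hd (f t)).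
Proof.
apply: tree_computable_comp.
exact: (tree_computable_expr (e := EHd (EVar 0))).
Qed.

Lemma tree_computable_tl (f : tree -> tree) :
  tree_computable f -> tree_computable (fun t => tl (f t)).
Proof.
apply: tree_computable_comp.
exact: (tree_computable_expr (e := ETl (EVar 0))).
Qed.

(** Variable [n] saves the input and [n.+1] the value of [f], both out of reach of the two commands;
    the successor in [n] keeps it distinct from variable 0. *)
Lemma tree_computable_cons (f g : tree -> tree) :
  tree_computable f -> tree_computable g ->
  tree_computable (fun t => Cons (f t) (g t)).
Proof.
move=> [cf [nf Hf]] [cg [ng Hg]]; set n := (maxn nf ng).+1.
exists (Seq (Assign n (EVar 0)) (Seq cf (Seq (Assign n.+1 (EVar 0))
  (Seq (Assign 0 (EVar n)) (Seq cg (Assign 0 (ECons (EVar n.+1) (EVar 0)))))))).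
exists n.+2 => s0.
have nfn : nf <= n by rewrite /n leqW ?leq_maxl.
have ngn : ng <= n by rewrite /n leqW ?leq_maxr.
pose s1 := upd s0 n (s0 0); have [s2 e2 [s2E s2P]] := Hf s1.
pose s3 := upd (upd s2 n.+1 (s2 0)) 0 (s2 n); have [s4 e4 [s4E s4P]] := Hg s3.
exists (upd s4 0 (Cons (s4 n.+1) (s4 0))).
  apply: (ExecSeq (s2 := s1)); first exact: ExecAssign.
  apply: ExecSeq e2 _; apply: ExecSeq; first exact: ExecAssign.
  apply: (ExecSeq (s2 := s3)).
    have -> : s3 = upd (upd s2 n.+1 (s2 0)) 0 (eval (upd s2 n.+1 (s2 0)) (EVar n)).
      by rewrite /s3 /= /upd ltn_eqF.
    exact: ExecAssign.
  by apply: ExecSeq e4 _; exact: ExecAssign.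
split=> [|[|y] ny] //; last first.
  rewrite /upd /= s4P; last by rewrite (leq_trans ngn) // ltnW // ltnW.
  rewrite /s3 /upd /= eqSS gtn_eqF // s2P; last first.
    by rewrite (leq_trans nfn) // ltnW // ltnW.
  by rewrite /s1 /upd gtn_eqF // ltnW.
have s4n : s4 n.+1 = f (s0 0).
  rewrite s4P; last exact: leqW.
  by rewrite /s3 /upd /= eqxx s2E.
have s2n : s2 n = s0 0 by rewrite s2P // /s1 /upd eqxx.
by rewrite {1}/upd eqxx s4n s4E /s3 {1}/upd eqxx s2n.
Qed.

Lemma tree_eqbE (t u : tree) : reflect (t = u) (tree_eqb t u).
Proof.
apply: (iffP idP) => [|<-]; last by elim: t => //= t1 -> t2 ->.
by elim: t u => [|t1 IH1 t2 IH2] [] //= u1 u2 /andP[/IH1 -> /IH2 ->].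
Qed.

Lemma tree_computable_eqb (f g : tree -> tree) :
  tree_computable f -> tree_computable g ->
  tree_computable (fun t => enc_bool (tree_eqb (f t) (g t))).
Proof.
move=> cf cg.
apply: (tree_computable_comp (f := fun t => enc_bool (tree_eqb (hd t) (tl t)))
                             (g := fun t => Cons (f t) (g t))).
  exact: (tree_computable_expr (e := EEq (EHd (EVar 0)) (ETl (EVar 0)))).
exact: tree_computable_cons.
Qed.

(* The step function may depend on the ambient input [t]; a command computing
   it receives [Cons t (Cons element accumulator)]. *)
Lemma tree_computable_fold (f : tree -> tree -> tree -> tree) (l a : tree -> tree) :
  tree_computable (fun u => f (hd u) (hd (tl u)) (tl (tl u))) ->
  tree_computable l -> tree_computable a ->
  tree_computable (fun t => tfold (f t) (l t) (a t)).
Proof.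
move=> cf cl ca.
(* First the case where ambient input, list and initial accumulator are packed in one tree; the
   general case precomposes with the packing. *)
have : tree_computable (fun u => tfold (f (hd u)) (hd (tl u)) (tl (tl u))).
  move: cf => [c [n0 Hc]]; set n := n0.+1.
  (* During the loop, variable [n] holds the ambient input, [n.+1] the rest of the list and 0 the
     accumulator. *)
  pose body := Seq (Assign 0 (ECons (EVar n) (ECons (EHd (EVar n.+1)) (EVar 0))))
                   (Seq (Assign n.+1 (ETl (EVar n.+1))) c).
  exists (Seq (Assign n (EHd (EVar 0))) (Seq (Assign n.+1 (EHd (ETl (EVar 0))))
    (Seq (Assign 0 (ETl (ETl (EVar 0)))) (While (EVar n.+1) body)))).
  exists n.+2 => s0.
  have loop t ls : forall s, s n = t -> s n.+1 = ls ->
      exists2 s', exec (While (EVar n.+1) body) s s' &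
        s' 0 = tfold (f t) ls (s 0) /\ forall y, n.+2 <= y -> s' y = s y.
    elim: ls => [|x _ ls IH] s sn sn1; first by exists s => //; exact: ExecWhileFalse.
    pose s1 := upd s 0 (Cons t (Cons x (s 0))); pose s2 := upd s1 n.+1 ls.
    have [s3 e3 [s3E s3P]] := Hc s2.
    have [] := IH s3.
    - by rewrite s3P ?leqnSn // /s2 /s1 /upd ltn_eqF.
    - by rewrite s3P ?leqW // /s2 /upd eqxx.
    move=> s4 e4 [s4E s4P]; exists s4.
      apply: ExecWhileTrue e4; first by rewrite /= sn1.
      apply: (ExecSeq (s2 := s1)).
        have -> : s1 = upd s 0 (eval s (ECons (EVar n) (ECons (EHd (EVar n.+1)) (EVar 0)))).
          by rewrite /= sn1 sn.
        exact: ExecAssign.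
      apply: ExecSeq e3.
      have -> : s2 = upd s1 n.+1 (eval s1 (ETl (EVar n.+1))).
        by rewrite /s2 /= {3}/s1 /upd /= sn1.
      exact: ExecAssign.
    split; first by rewrite s4E s3E.
    move=> y ny; rewrite s4P // s3P; last by rewrite ltnW // ltnW // ltnW.
    by rewrite /s2 /s1 /upd gtn_eqF //; case: y ny.
  pose s1 := upd s0 n (hd (s0 0)).
  pose s2 := upd s1 n.+1 (hd (tl (s0 0))).
  pose s3 := upd s2 0 (tl (tl (s0 0))).
  have [] := loop (hd (s0 0)) (hd (tl (s0 0))) s3.
  - by rewrite /s3 /s2 /s1 /upd /= ltn_eqF // eqxx.
  - by rewrite /s3 /s2 /upd /= eqxx.
  move=> s4 e4 [s4E s4P]; exists s4.
    apply: (ExecSeq (s2 := s1)); first exact: (ExecAssign s0 n (EHd (EVar 0))).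
    apply: (ExecSeq (s2 := s2)).
      exact: (ExecAssign s1 n.+1 (EHd (ETl (EVar 0)))).
    apply: ExecSeq e4; exact: (ExecAssign s2 0 (ETl (ETl (EVar 0)))).
  split=> // y ny; rewrite s4P // /s3 /s2 /s1 /upd.
  by rewrite !gtn_eqF // ?(leq_trans _ ny) // ltnW.
move=> cF; apply: (tree_computable_comp (g := fun t => Cons t (Cons (l t) (a t))) cF).
apply: tree_computable_cons tree_computable_id _.
exact: tree_computable_cons.
Qed.

(** * List operations on trees *)

Definition trev (l : tree) : tree := tfold Cons l Nil.
(** Consing in a left fold reverses, so [l] is reversed beforehand. *)
Definition tcat (l m : tree) : tree := tfold Cons (trev l) m.
Definition tmap (f : tree -> tree) (l : tree) : tree :=
  trev (tfold (fun x acc => Cons (f x) acc) l Nil).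
(** The test serves as a list: [enc_bool true] has one element, so the step runs once and yields
    [u], whereas [Nil] leaves [v]. *)
Definition tif (b u v : tree) : tree := tfold (fun _ _ => u) b v.
Definition tmem (x l : tree) : tree :=
  tfold (fun y acc => tif (enc_bool (tree_eqb x y)) (enc_bool true) acc) l Nil.
(* The state of the fold is what remains of [m], paired with the reversed result. *)
Definition tzip (l m : tree) : tree :=
  trev (tl (tfold (fun x st =>
    Cons (tl (hd st)) (Cons (Cons x (hd (hd st))) (tl st))) l (Cons m Nil))).

Ltac tree_comp := repeat first
  [ exact: tree_computable_id | apply: tree_computable_const
  | apply: tree_computable_hd | apply: tree_computable_tl
  | apply: tree_computable_eqb | apply: tree_computable_cons | done ].

Lemma tree_computable_rev (f : tree -> tree) :
  tree_computable f -> tree_computable (fun t => trev (f t)).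
Proof. by move=> cf; apply: (tree_computable_fold (f := fun=> Cons)); tree_comp. Qed.

Lemma tree_computable_cat (f g : tree -> tree) :
  tree_computable f -> tree_computable g ->
  tree_computable (fun t => tcat (f t) (g t)).
Proof.
move=> cf cg; apply: (tree_computable_fold (f := fun=> Cons)) => //.
  by tree_comp.
exact: tree_computable_rev.
Qed.

Lemma tree_computable_map (f : tree -> tree -> tree) (l : tree -> tree) :
  tree_computable (fun u => f (hd u) (tl u)) -> tree_computable l ->
  tree_computable (fun t => tmap (f t) (l t)).
Proof.
move=> cf cl; apply: tree_computable_rev.
apply: (tree_computable_fold (f := fun t x acc => Cons (f t x) acc)) => //.
  apply: tree_computable_cons; last by tree_comp.
  (* The fold step is fed [Cons t (Cons x acc)], while the command for [f] expects [Cons t x]. *)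
  apply: (tree_computable_comp (g := fun u => Cons (hd u) (hd (tl u))) cf).
  by tree_comp.
exact: tree_computable_const.
Qed.

Lemma tree_computable_if (b u v : tree -> tree) :
  tree_computable b -> tree_computable u -> tree_computable v ->
  tree_computable (fun t => tif (b t) (u t) (v t)).
Proof.
move=> cb cu cv; apply: (tree_computable_fold (f := fun t _ _ => u t)) => //.
by apply: (tree_computable_comp cu); tree_comp.
Qed.

Lemma tree_computable_mem (f l : tree -> tree) :
  tree_computable f -> tree_computable l ->
  tree_computable (fun t => tmem (f t) (l t)).
Proof.
move=> cf cl; apply: (tree_computable_fold (f := fun t y acc =>
  tif (enc_bool (tree_eqb (f t) y)) (enc_bool true) acc)) => //; last by tree_comp.
apply: tree_computable_if; tree_comp.
by apply: (tree_computable_comp cf); tree_comp.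
Qed.

Lemma tree_computable_zip (f g : tree -> tree) :
  tree_computable f -> tree_computable g ->
  tree_computable (fun t => tzip (f t) (g t)).
Proof.
move=> cf cg; apply/tree_computable_rev/tree_computable_tl.
by apply: (tree_computable_fold (f := fun _ x st =>
  Cons (tl (hd st)) (Cons (Cons x (hd (hd st))) (tl st)))); tree_comp.
Qed.

(** * List operations on encoded data *)

Lemma tfold_enc_seq T (enc : T -> tree) f (s : seq T) acc :
  tfold f (enc_seq enc s) acc = foldl (fun a x => f (enc x) a) acc s.
Proof. by elim: s acc => //= x s IH acc. Qed.

Lemma trev_enc T (enc : T -> tree) (s : seq T) :
  trev (enc_seq enc s) = enc_seq enc (rev s).
Proof.
rewrite /trev tfold_enc_seq /rev -[Nil]/(enc_seq enc [::]).
by elim: s [::] => //= x s IH s'; rewrite -IH.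
Qed.

Lemma tcat_enc T (enc : T -> tree) (s s' : seq T) :
  tcat (enc_seq enc s) (enc_seq enc s') = enc_seq enc (s ++ s').
Proof.
rewrite /tcat trev_enc tfold_enc_seq -[s in RHS]revK.
by elim: (rev s) s' => [|x r IH] s' //=; rewrite rev_cons cat_rcons -IH.
Qed.

Lemma tmap_enc T U (enc : T -> tree) (enc' : U -> tree) f g (s : seq T) :
  (forall x, f (enc x) = enc' (g x)) ->
  tmap f (enc_seq enc s) = enc_seq enc' (map g s).
Proof.
move=> fg; rewrite /tmap tfold_enc_seq.
have foldE s' : foldl (fun a x => Cons (f (enc x)) a) (enc_seq enc' s') s
                = enc_seq enc' (catrev (map g s) s').
  by elim: s s' => //= x s IH s'; rewrite fg -IH.
by rewrite (foldE [::]) trev_enc revK.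
Qed.

Lemma tif_enc (b : bool) (u v : tree) : tif (enc_bool b) u v = if b then u else v.
Proof. by case: b. Qed.

Lemma tmem_enc (T : eqType) (enc : T -> tree) (x : T) (s : seq T) :
  injective enc -> tmem (enc x) (enc_seq enc s) = enc_bool (x \in s).
Proof.
move=> encI; rewrite /tmem tfold_enc_seq -[Nil]/(enc_bool false).
(* For the induction the initial accumulator becomes an arbitrary Boolean [b], and the fold computes
   [b || (x \in s)]. *)
rewrite -[in RHS](orFb (x \in s)); elim: s false => [|y s IH] b /=.
  by rewrite orbF.
rewrite tif_enc in_cons.
have -> : tree_eqb (enc x) (enc y) = (x == y).
  by apply/tree_eqbE/eqP => [/encI|->].
by case: (x == y); rewrite /= ?orbT; [exact: (IH true) | exact: IH].
Qed.

Lemma tzip_enc T U (encT : T -> tree) (encU : U -> tree) (s : seq T) (s' : seq U) :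
  size s = size s' ->
  tzip (enc_seq encT s) (enc_seq encU s')
  = enc_seq (enc_pair encT encU) (zip s s').
Proof.
rewrite /tzip tfold_enc_seq => eqs.
set F := (F in foldl F).
have FE r : foldl F (Cons (enc_seq encU s') (enc_seq (enc_pair encT encU) r)) s
          = Cons Nil (enc_seq (enc_pair encT encU) (catrev (zip s s') r)).
  elim: s s' r eqs => [|x s IH] [|y s'] r //= [] /IH <- //.
by rewrite (FE [::]) trev_enc revK.
Qed.

(** A unary numeral is a list of empty trees, so concatenation of lists serves as addition. *)
Lemma enc_natE n : enc_nat n = enc_seq (fun _ : unit => Nil) (nseq n tt).
Proof. by elim: n => //= n ->. Qed.

Lemma tcat_enc_nat m n : tcat (enc_nat m) (enc_nat n) = enc_nat (m + n).
Proof. by rewrite !enc_natE tcat_enc nseqD. Qed.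

Lemma computable_of_tree (P Q : decision_problem) (f : instance P -> instance Q) F :
  tree_computable F -> (forall x, F (encode x) = encode (f x)) -> computable f.
Proof.
move=> [c [n H]] FE; exists (Program 0 c 0) => x.
by have [s e [sE _]] := H (upd (fun=> Nil) 0 (encode x)); exists s; rewrite // sE -FE.
Qed.

(** * Removing the private locations *)

(** Two contradictory constraints exclude every valuation, including those with negative values,
    which the type [valuation] allows. *)
Definition false_guard : guard := [:: (0, CmpLt, 0%R); (0, CmpGt, 0%R)].

Lemma sat_false_guard (R : realType) (mu : valuation R) : sat mu false_guard = false.
Proof. by rewrite /sat /= andbT; exact: lt_asym. Qed.

Definition public_invs (A : ta_data) : seq guard :=
  [seq if p.1 \in ta_priv A then false_guard else p.2
  | p <- zip (ta_locs A) (ta_invs A)].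

(** Clock 0 is added because [false_guard] mentions it; an extra clock does not affect the runs. *)
Definition public_data (A : ta_data) : ta_data :=
  TAData (ta_actions A) (ta_locs A) (ta_init A) (ta_priv A) (ta_final A)
    (0 :: ta_clocks A) (public_invs A) (ta_edges A).

Lemma guard_wf_sub (X Y : seq nat) (g : guard) :
  {subset X <= Y} -> guard_wf X g -> guard_wf Y g.
Proof. by move=> XY; apply: sub_all => c; exact: XY. Qed.

Lemma public_wf (A : timed_automaton) : ta_wf (public_data A).
Proof.
case: A => A /= /and5P[uL iL pL fL /and3P[/eqP sI wI wE]].
have XS : {subset ta_clocks A <= 0 :: ta_clocks A}.
  by move=> x; rewrite in_cons orbC => ->.
rewrite /ta_wf /= uL iL pL fL size_map size_zip sI minnn eqxx /=; apply/andP; split.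
  apply/allP => _ /mapP[[l g] /= lg ->]; case: ifP => // _.
  apply: guard_wf_sub XS _; apply: (allP wI).
  have -> : ta_invs A = unzip2 (zip (ta_locs A) (ta_invs A)) by rewrite unzip2_zip ?sI.
  by apply/mapP; exists (l, g).
apply: sub_all wE => e /and5P[? ? gX rX aX]; apply/and5P; split=> //.
  exact: guard_wf_sub gX.
by apply: sub_all rX => x; exact: XS.
Qed.

Definition public_ta (A : timed_automaton) : timed_automaton :=
  TimedAutomaton (public_wf A).

Lemma public_inv (A : timed_automaton) (l : nat) :
  ta_inv (public_ta A) l = if l \in ta_priv A then false_guard else ta_inv A l.
Proof.
rewrite /ta_inv /= /public_invs.
case: A => A /= /and5P[_ _ /allP pL _ /and3P[/eqP sI _ _]].
have [lL|lL] := boolP (l \in ta_locs A).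
  rewrite (nth_map (l, [::])) ?size_zip ?sI ?minnn ?index_mem //.
  by rewrite nth_zip ?sI //= nth_index.
(* Outside [ta_locs A] both invariants are the default empty guard, and well-formedness excludes
   that such an [l] is private. *)
rewrite (memNindex lL) nth_default; last by rewrite size_map size_zip sI minnn.
rewrite nth_default ?sI //; case: ifP => // /pL; by rewrite /= (negPf lL).
Qed.

Lemma public_sat (R : realType) (A : timed_automaton) (mu : valuation R) (l : nat) :
  sat mu (ta_inv (public_ta A) l) = (l \notin ta_priv A) && sat mu (ta_inv A l).
Proof. by rewrite public_inv; case: ifP => // _; rewrite sat_false_guard. Qed.

(** Every edge checks the invariant of the location it enters, so unsatisfiable invariants keep the
    path out of the private locations. The hypothesis on [c] takes care of the start, where an empty
    path checks nothing. *)
Lemma public_path (R : realType) (A : timed_automaton) (c : config R) r :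
  c.1 \notin ta_priv A ->
  is_path (public_ta A) c r <->
  is_path A c r /\ all (fun l => l \notin ta_priv A) (run_locs r).
Proof.
elim: r c => [|[[d e] c'] r IH] c cP //=.
have delayE : delay_ok (public_ta A) c d <-> delay_ok A c d.
  by split=> -[d0 H]; split=> // d' /H; rewrite public_sat cP.
split.
  move=> [/delayE ok [estep [g res]]]; rewrite public_sat => /andP[cP' sa].
  by move=> /(IH _ cP')[pa al]; split=> //; rewrite cP'.
move=> [[/delayE ok [estep [g res sa]] pa] /andP[cP' al]]; split=> //.
  by do 2!split=> //; rewrite public_sat cP'.
by apply/(IH _ cP').
Qed.

(** The initial location is treated apart from the path: [is_run] tests its invariant before any
    step, which rules out a private start. *)
Lemma public_run (R : realType) (A : timed_automaton) (r : seq (run_step R)) :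
  is_run (public_ta A) r <-> is_run A r /\ ~~ is_private A r.
Proof.
rewrite /is_private /= negb_or -all_predC.
have pathE := @public_path R A (ta_init A, fun=> 0%R) r; split.
  move=> [+ pa la be]; rewrite public_sat => /andP[iP sa].
  by have /(_ iP)[/(_ pa)[paA al] _] := pathE; split=> //; rewrite iP.
move=> [[sa pa la be] /andP[iP al]]; split=> //; first by rewrite public_sat iP.
by apply/pathE.
Qed.

Lemma weakly_opaque_inclusion (R : realType) (A : timed_automaton) :
  weakly_opaque R A <-> (@Tr R A `<=` @Tr R (public_ta A))%classic.
Proof.
split=> H w.
  move=> [r rA rw]; have [rP|rP] := boolP (is_private A r).
    have [|r' [r'A r'P r'w]] := H w; first by exists r.
    by exists r' => //; exact/public_run.
  by exists r => //; exact/public_run.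
move=> [r [rA rP rw]]; have [|r' /public_run[r'A r'P] r'w] := H w; first by exists r.
by exists r'.
Qed.

(** The projections follow the field order of [enc_ta]: [t3] begins with the private locations and
    [t5] with the clocks. *)
Definition tree_public (t : tree) : tree :=
  let L := hd (tl t) in
  let t3 := tl (tl (tl t)) in
  let t5 := tl (tl t3) in
  Cons (hd t) (Cons L (Cons (hd (tl (tl t))) (Cons (hd t3) (Cons (hd (tl t3))
    (Cons (Cons (enc_nat 0) (hd t5))
      (Cons (tmap (fun p => tif (tmem (hd p) (hd t3)) (enc_guard false_guard) (tl p))
               (tzip L (hd (tl t5))))
        (tl (tl t5)))))))).

Lemma tree_public_enc (A : timed_automaton) :
  tree_public (enc_ta A) = enc_ta (public_ta A).
Proof.
rewrite /tree_public /enc_ta [hd _]/= [tl _]/= /=.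
case: A => A /= /and5P[_ _ _ _ /and3P[/eqP sI _ _]].
rewrite tzip_enc //.
rewrite (tmap_enc (enc' := enc_guard)
  (g := fun p => if p.1 \in ta_priv A then false_guard else p.2)) //.
by case=> l g /=; rewrite (tmem_enc _ _ enc_nat_inj) tif_enc; case: ifP.
Qed.

Lemma tree_computable_public : tree_computable tree_public.
Proof.
rewrite /tree_public; tree_comp; apply: (tree_computable_map (f := fun t p =>
  tif (tmem (hd p) (hd (tl (tl (tl t))))) (enc_guard false_guard) (tl p))).
  by apply: tree_computable_if; tree_comp; apply: tree_computable_mem; tree_comp.
by apply: tree_computable_zip; tree_comp.
Qed.

Lemma weak_opacity_reduces (R : realType) :
  many_one_reduces (weak_opacity R) (timed_language_inclusion R).
Proof.
exists (fun A => (A, public_ta A)); split; last exact: weakly_opaque_inclusion.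
apply: (computable_of_tree (F := fun t => Cons t (tree_public t))).
  by apply: tree_computable_cons tree_computable_id tree_computable_public.
by move=> A; rewrite /= /enc_pair /= tree_public_enc.
Qed.

(** * Disjoint union *)

Definition rename_edge (h : nat -> nat) (e : edge) : edge :=
  Edge (h (edge_src e)) (edge_guard e) (edge_label e) (edge_reset e) (h (edge_tgt e)).

Definition rename_step (R : realType) (h : nat -> nat) (s : run_step R) : run_step R :=
  (s.1.1, rename_edge h s.1.2, (h s.2.1, s.2.2)).

(* [C] behaves like [A], along [h], from every location in the range of [h]. *)
Definition embeds (h : nat -> nat) (A C : timed_automaton) : Prop :=
  [/\ injective h,
      forall l, ta_inv C (h l) = ta_inv A l,
      forall l e, edge_src e = h l ->
        (e \in ta_edges C) = (e \in map (rename_edge h) (ta_edges A)) &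
      forall l, (h l \in ta_final C) = (l \in ta_final A)].

(** With all clocks at 0, this is what remains of a run of the union once its silent start edge is
    taken. *)
Definition run_from (R : realType) (A : timed_automaton) (l : nat)
    (r : seq (run_step R)) : Prop :=
  [/\ sat (fun _ : nat => 0%R : R) (ta_inv A l),
      is_path A (l, fun _ => 0%R) r,
      last l (run_locs r) \in ta_final A &
      all (fun l' => l' \notin ta_final A) (belast l (run_locs r))].

(** The edges of [C] leaving the range of [h] are the renamed edges of [A], whose targets are again
    in the range, so a path starting there never leaves it. Guards, resets and invariants are the
    same on both sides. *)
Lemma embeds_path (R : realType) h (A C : timed_automaton) l mu (r : seq (run_step R)) :
  embeds h A C ->
  is_path C (h l, mu) r <->
  exists2 r', is_path A (l, mu) r' & r = map (rename_step h) r'.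
Proof.
move=> [hI hinv hedge _].
have delayE l1 mu1 (d : R) : delay_ok C (h l1, mu1) d <-> delay_ok A (l1, mu1) d.
  by rewrite /delay_ok /= hinv.
split.
  elim: r l mu => [|[[d e] [l' mu']] r IH] l mu /=; first by exists [::].
  move=> [/delayE ok [[eC /= es et] [g res sa]] pa].
  have := eC; rewrite (hedge _ _ es) => /mapP[e' e'A eE].
  move: es et g res sa pa; rewrite eE /= => /hI es <- g res sa pa.
  have [r' r'A ->] := IH _ _ pa.
  exists ((d, e', (edge_tgt e', mu')) :: r') => //=; split=> //.
  by rewrite hinv in sa.
move=> [r' + ->]; elim: r' l mu {r} => [|[[d e] [l' mu']] r IH] l mu //=.
move=> [/delayE ok [[eA /= es et] [g res sa]] pa]; split=> //; last exact: IH.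
split; split; rewrite /= ?es ?et ?hinv //.
rewrite (hedge l) /= ?es //; exact: (map_f (rename_edge h) eA).
Qed.

Lemma run_locs_rename (R : realType) h (r : seq (run_step R)) :
  run_locs (map (rename_step h) r) = map h (run_locs r).
Proof. by rewrite /run_locs -!map_comp. Qed.

Lemma trace_rename (R : realType) h t (r : seq (run_step R)) :
  trace_from t (map (rename_step h) r) = trace_from t r.
Proof. by elim: r t => [|[[d e] c] r IH] t //=; rewrite !IH. Qed.

Lemma belast_map T U (f : T -> U) x s : belast (f x) (map f s) = map f (belast x s).
Proof. by elim: s x => //= y s IH x; rewrite IH. Qed.

Lemma embeds_run (R : realType) h (A C : timed_automaton) l (r : seq (run_step R)) :
  embeds h A C ->
  run_from C (h l) r <-> exists2 r', run_from A l r' & r = map (rename_step h) r'.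
Proof.
move=> hAC; have [_ hinv _ hfin] := hAC.
have finE r' : (last (h l) (run_locs (map (rename_step h) r')) \in ta_final C) =
               (last l (run_locs (R := R) r') \in ta_final A).
  by rewrite run_locs_rename last_map hfin.
have nfinE r' : all (fun l' => l' \notin ta_final C)
                  (belast (h l) (run_locs (map (rename_step h) r'))) =
                all (fun l' => l' \notin ta_final A) (belast l (run_locs (R := R) r')).
  by rewrite run_locs_rename belast_map all_map; apply: eq_all => l' /=; rewrite hfin.
split.
  move=> [sa /(embeds_path _ _ _ hAC)[r' pa rE] la be]; exists r' => //.
  by move: la be; rewrite rE finE nfinE => la be; split=> //; rewrite -hinv.
move=> [r' [sa pa la be] ->]; split; rewrite ?hinv ?finE ?nfinE //.
by apply/(embeds_path _ _ _ hAC); exists r'.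
Qed.

(** * Construction of the union *)

(* Location [0] is left free for the initial location of the union. *)
Definition copy_loc (b : bool) (n : nat) : nat := (b + n.*2).+1.

(** After removing the successor, [b] is recovered as the parity and the location by halving. *)
Lemma eq_copy_loc b b' m n :
  (copy_loc b m == copy_loc b' n) = (b == b') && (m == n).
Proof.
apply/eqP/andP => [[E]|[/eqP-> /eqP->] //].
split; last by rewrite -(half_bit_double m b) E half_bit_double.
by have := congr1 odd E; rewrite !oddD !odd_double !addbF !oddb => ->.
Qed.

Lemma copy_loc_inj b : injective (copy_loc b).
Proof. by move=> m n /eqP; rewrite eq_copy_loc eqxx => /eqP. Qed.

(* At location [0] every clock equals the elapsed time, so the guard on clock
   [0] forbids delays there, even if this clock is used by [A] or [B]. *)
Definition start_edge (b : bool) (l : nat) : edge :=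
  Edge 0 [:: (0, CmpEq, 0%R)] None [::] (copy_loc b l).

(** A run enters only one of the two copies, so they may share clocks and actions. Clock 0 is listed
    for the guard of the start edges, and the leading empty guard is the invariant of location 0. *)
Definition union_data (A B : ta_data) : ta_data :=
  TAData (ta_actions A ++ ta_actions B)
    (0 :: map (copy_loc false) (ta_locs A) ++ map (copy_loc true) (ta_locs B))
    0
    [:: copy_loc false (ta_init A)]
    (map (copy_loc false) (ta_final A) ++ map (copy_loc true) (ta_final B))
    (0 :: ta_clocks A ++ ta_clocks B)
    ([::] :: ta_invs A ++ ta_invs B)
    (start_edge false (ta_init A) :: start_edge true (ta_init B) ::
      map (rename_edge (copy_loc false)) (ta_edges A) ++
      map (rename_edge (copy_loc true)) (ta_edges B)).

Lemma mem_copy_loc b b' n s :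
  (copy_loc b n \in map (copy_loc b') s) = (b == b') && (n \in s).
Proof.
have [<-|bb'] /= := eqVneq b b'; first exact: mem_map (@copy_loc_inj b) _ _.
by apply/negP => /mapP[m _ /eqP]; rewrite eq_copy_loc (negPf bb').
Qed.

Lemma rename_edge_wf b (A C : ta_data) :
  {subset map (copy_loc b) (ta_locs A) <= ta_locs C} ->
  {subset ta_clocks A <= ta_clocks C} ->
  {subset ta_actions A <= ta_actions C} ->
  all (edge_wf A) (ta_edges A) ->
  all (edge_wf C) (map (rename_edge (copy_loc b)) (ta_edges A)).
Proof.
move=> LS XS SS /allP wE; apply/allP => _ /mapP[e /wE /and5P[es et gX rX aX] ->].
apply/and5P; split=> /=.
- exact/LS/map_f.
- exact/LS/map_f.
- exact: guard_wf_sub gX.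
- by apply: sub_all rX => x; exact: XS.
- by case: (edge_label e) aX => // a; exact: SS.
Qed.

Lemma union_wf (A B : timed_automaton) : ta_wf (union_data A B).
Proof.
case: A B => [A +] [B +] /=.
move=> /and5P[uLA iLA pLA fLA /and3P[/eqP sIA wIA wEA]].
move=> /and5P[uLB iLB pLB fLB /and3P[/eqP sIB wIB wEB]].
have XA : {subset ta_clocks A <= 0 :: ta_clocks A ++ ta_clocks B}.
  by move=> x xA; rewrite in_cons mem_cat xA orbT.
have XB : {subset ta_clocks B <= 0 :: ta_clocks A ++ ta_clocks B}.
  by move=> x xB; rewrite in_cons mem_cat xB !orbT.
have LA : {subset map (copy_loc false) (ta_locs A) <= ta_locs (union_data A B)}.
  by move=> x xA; rewrite in_cons mem_cat xA orbT.
have LB : {subset map (copy_loc true) (ta_locs B) <= ta_locs (union_data A B)}.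
  by move=> x xB; rewrite in_cons mem_cat xB !orbT.
rewrite /ta_wf; apply/and5P; split; last apply/and3P; last split.
- rewrite cons_uniq cat_uniq !map_inj_uniq ?uLA ?uLB; try exact: copy_loc_inj.
  rewrite mem_cat negb_or andbT /=; apply/andP; split.
    by apply/andP; split; apply/negP => /mapP[].
  by apply/hasPn => _ /mapP[n _ ->]; rewrite /= mem_copy_loc.
- exact: mem_head.
- by rewrite /= andbT; apply/LA/map_f.
- rewrite all_cat; apply/andP; split; apply/allP => _ /mapP[n nF ->].
    by apply/LA/map_f/(allP fLA).
  by apply/LB/map_f/(allP fLB).
- by rewrite /= !size_cat !size_map sIA sIB.
- rewrite /= all_cat; apply/andP; split.
    by apply: sub_all wIA => g; exact: guard_wf_sub.
  by apply: sub_all wIB => g; exact: guard_wf_sub.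
rewrite /= all_cat; apply/and4P; split.
- by apply/and5P; split=> //; apply/LA/map_f.
- by apply/and5P; split=> //; apply/LB/map_f.
- by apply: rename_edge_wf => // a aA; rewrite mem_cat aA.
- by apply: rename_edge_wf => // a aB; rewrite mem_cat aB orbT.
Qed.

Definition union_ta (A B : timed_automaton) : timed_automaton :=
  TimedAutomaton (union_wf A B).

Lemma mem_rename_copy b b' l e (s : seq edge) :
  edge_src e = copy_loc b l ->
  e \in map (rename_edge (copy_loc b')) s -> b = b'.
Proof.
move=> es /mapP[e' _ eE]; move: es; rewrite eE /= => /eqP.
by rewrite eq_copy_loc => /andP[/eqP].
Qed.

Lemma union_embedsl (A B : timed_automaton) :
  embeds (copy_loc false) A (union_ta A B).
Proof.
split; first exact: copy_loc_inj.
- move=> l; have /and5P[_ _ _ _ /and3P[/eqP sIA _ _]] := ta_ofP A.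
  have /and5P[_ _ _ _ /and3P[/eqP sIB _ _]] := ta_ofP B.
  rewrite /ta_inv /= index_cat mem_copy_loc /= nth_cat.
  have [lA|lA] := boolP (l \in ta_locs A).
    by rewrite index_map ?sIA ?index_mem ?lA //; exact: copy_loc_inj.
  (* For an absent [l] the index falls past the invariants of both automata, and both sides are the
     default empty guard. *)
  rewrite memNindex ?mem_copy_loc // !size_map sIA ltnNge leq_addr /= addKn.
  by rewrite !nth_default ?sIB // memNindex ?sIA.
(* Start edges have source 0, and edges of the other copy have sources of the other parity, so
   neither leaves [copy_loc false l]. *)
- move=> l e es; rewrite !in_cons mem_cat.
  have -> : (e == start_edge false (ta_init A)) = false.
    by apply/eqP => eE; move: es; rewrite eE.
  have -> : (e == start_edge true (ta_init B)) = false.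
    by apply/eqP => eE; move: es; rewrite eE.
  by rewrite !orFb; case: (boolP (e \in map _ (ta_edges B))) => [/(mem_rename_copy es)|];
     rewrite ?orbF.
- by move=> l; rewrite mem_cat !mem_copy_loc orbF.
Qed.

Lemma union_embedsr (A B : timed_automaton) :
  embeds (copy_loc true) B (union_ta A B).
Proof.
split; first exact: copy_loc_inj.
- move=> l; have /and5P[_ _ _ _ /and3P[/eqP sIA _ _]] := ta_ofP A.
  rewrite /ta_inv /= index_cat mem_copy_loc /= nth_cat.
  (* The locations of [A] come first and shift the index by the number of invariants of [A];
     [index_map] also covers an absent [l]. *)
  rewrite size_map sIA ltnNge leq_addr /= addKn index_map //; exact: copy_loc_inj.
- move=> l e es; rewrite !in_cons mem_cat.
  have -> : (e == start_edge false (ta_init A)) = false.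
    by apply/eqP => eE; move: es; rewrite eE.
  have -> : (e == start_edge true (ta_init B)) = false.
    by apply/eqP => eE; move: es; rewrite eE.
  by rewrite !orFb; case: (boolP (e \in map _ (ta_edges A))) => [/(mem_rename_copy es)|].
- by move=> l; rewrite mem_cat !mem_copy_loc.
Qed.

(** * Runs and traces of the union *)

Definition start_step (R : realType) (b : bool) (l : nat) : run_step R :=
  (0%R, start_edge b l, (copy_loc b l, fun=> 0%R)).

Lemma union_start (R : realType) (A B : timed_automaton) b l (r : seq (run_step R)) :
  start_edge b l \in ta_edges (union_ta A B) ->
  run_from (union_ta A B) (copy_loc b l) r -> is_run (union_ta A B) (start_step R b l :: r).
Proof.
move=> eC [sa pa la be].
have z0 : val_shift (fun=> 0%R : R) 0%R = fun=> 0%R.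
  by apply/funext => x; rewrite /val_shift addr0.
split=> //=; last first.
  (* Location 0 is not a copy, hence not final. *)
  rewrite be andbT mem_cat negb_or.
  by apply/andP; split; apply/negP => /mapP[].
split; last exact: pa; first by split.
by split; split=> //=; rewrite z0 //= eqxx.
Qed.

(** As location 0 is not final, a run has a first step; copied edges have nonzero sources, so this
    step takes a start edge. Its guard forces a zero delay, and the chosen copy is entered at time 0
    with all clocks at 0. *)
Lemma union_run_inv (R : realType) (A B : timed_automaton) (r : seq (run_step R)) :
  is_run (union_ta A B) r ->
  exists b, let l := ta_init (if b then B else A) in
  exists2 r', run_from (union_ta A B) (copy_loc b l) r' & r = start_step R b l :: r'.
Proof.
move=> [_]; case: r => [|[[d e] [l' mu]] r] /=.
  by move=> _; rewrite mem_cat => /orP[] /mapP[].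
move=> [_ [[eC /= es et] [g res sa]] pa] la /andP[_ be].
have [b eE] : exists b, e = start_edge b (ta_init (if b then B else A)).
  move: eC; rewrite !in_cons mem_cat => /or4P[/eqP->|/eqP->|/mapP|/mapP].
  - by exists false.
  - by exists true.
  - by move=> [e' _ eE]; move: es; rewrite eE.
  - by move=> [e' _ eE]; move: es; rewrite eE.
move: et g res sa pa la be; rewrite eE /= => <-.
(* The guard on clock 0 now reads [d == 0]. *)
rewrite /val_shift /= andbT add0r => /eqP -> res.
have -> : mu = fun=> 0%R by apply/funext => x; rewrite res.
by exists b, r.
Qed.

Lemma trace_start (R : realType) b l h (r : seq (run_step R)) :
  trace (start_step R b l :: map (rename_step h) r) = trace r.
Proof. by rewrite /trace /= addr0 trace_rename. Qed.

Lemma union_startl_private (R : realType) (A B : timed_automaton) r :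
  is_private (union_ta A B) (start_step R false (ta_init A) :: r).
Proof.
by apply/hasP; exists (copy_loc false (ta_init A)); rewrite /= !inE ?eqxx ?orbT.
Qed.

Lemma union_PrivTr (R : realType) (A B : timed_automaton) :
  PrivTr (R := R) (union_ta A B) = Tr A.
Proof.
have HA := union_embedsl A B; have HB := union_embedsr A B.
apply/seteqP; split=> w.
  move=> [r [/union_run_inv[[] [r1 r1C ->]]]].
    have /(embeds_run _ _ HB)[r2 _ ->] := r1C.
    (* A run through the copy of [B] visits only location 0 and locations [copy_loc true _], none of
       which is the private location [copy_loc false (ta_init A)]. *)
    move=> /hasP[l]; rewrite /= run_locs_rename !inE.
    by move=> /or3P[/eqP->|/eqP->|/mapP[l' _ ->]]; rewrite ?eq_copy_loc.
  have /(embeds_run _ _ HA)[r2 r2A ->] := r1C => _ rw.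
  by exists r2 => //; rewrite -rw trace_start.
move=> [r rA rw]; exists (start_step R false (ta_init A) ::
                         map (rename_step (copy_loc false)) r); split.
- apply: union_start; first exact: mem_head.
  by apply/(embeds_run _ _ HA); exists r.
- exact: union_startl_private.
- by rewrite trace_start.
Qed.

Lemma union_PubTr (R : realType) (A B : timed_automaton) :
  PubTr (R := R) (union_ta A B) = Tr B.
Proof.
have HB := union_embedsr A B.
apply/seteqP; split=> w.
  move=> [r [/union_run_inv[[] [r1 r1C ->]]]].
    have /(embeds_run _ _ HB)[r2 r2B ->] := r1C => _ rw.
    by exists r2 => //; rewrite -rw trace_start.
  by rewrite union_startl_private.
move=> [r rB rw]; exists (start_step R true (ta_init B) ::
                         map (rename_step (copy_loc true)) r); split.
- apply: union_start; first by rewrite inE mem_head orbT.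
  by apply/(embeds_run _ _ HB); exists r.
- apply/hasPn => l; rewrite /= run_locs_rename !inE.
  by move=> /or3P[/eqP->|/eqP->|/mapP[l' _ ->]]; rewrite ?eq_copy_loc.
- by rewrite trace_start.
Qed.

(** * The union computed on trees *)

Definition tree_copy (b : bool) (t : tree) : tree :=
  Cons Nil (tcat (enc_nat b) (tcat t t)).

Definition tree_rename_edge (b : bool) (t : tree) : tree :=
  Cons (tree_copy b (hd t)) (Cons (hd (tl t)) (Cons (hd (tl (tl t)))
    (Cons (hd (tl (tl (tl t)))) (tree_copy b (tl (tl (tl (tl t)))))))).

Definition tree_start_edge (b : bool) (t : tree) : tree :=
  Cons Nil (Cons (enc_guard [:: (0, CmpEq, 0%R)]) (Cons Nil (Cons Nil (tree_copy b t)))).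

(** The i-th field of the encoding of [A] is the head of the i-th of [a1], ..., [a7], and the last
    field, the edges, is [a8] itself; likewise for [B] with [b1], ..., [b8]. *)
Definition tree_union (t : tree) : tree :=
  let a1 := hd t in let a2 := tl a1 in let a3 := tl a2 in let a4 := tl a3 in
  let a5 := tl a4 in let a6 := tl a5 in let a7 := tl a6 in let a8 := tl a7 in
  let b1 := tl t in let b2 := tl b1 in let b3 := tl b2 in let b4 := tl b3 in
  let b5 := tl b4 in let b6 := tl b5 in let b7 := tl b6 in let b8 := tl b7 in
  Cons (tcat (hd a1) (hd b1))
  (Cons (Cons Nil (tcat (tmap (tree_copy false) (hd a2)) (tmap (tree_copy true) (hd b2))))
  (Cons Nil
  (Cons (Cons (tree_copy false (hd a3)) Nil)
  (Cons (tcat (tmap (tree_copy false) (hd a5)) (tmap (tree_copy true) (hd b5)))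
  (Cons (Cons Nil (tcat (hd a6) (hd b6)))
  (Cons (Cons Nil (tcat (hd a7) (hd b7)))
  (Cons (tree_start_edge false (hd a3))
  (Cons (tree_start_edge true (hd b3))
  (tcat (tmap (tree_rename_edge false) a8) (tmap (tree_rename_edge true) b8)))))))))).

(** On unary numerals, appending [t] to itself doubles, and the outer [Cons Nil] is the
    successor. *)
Lemma tree_copy_enc b n : tree_copy b (enc_nat n) = enc_nat (copy_loc b n).
Proof. by rewrite /tree_copy !tcat_enc_nat addnn. Qed.

Lemma tree_rename_edge_enc b e :
  tree_rename_edge b (enc_edge e) = enc_edge (rename_edge (copy_loc b) e).
Proof. by rewrite /tree_rename_edge /= !tree_copy_enc. Qed.

Lemma tree_start_edge_enc b l :
  tree_start_edge b (enc_nat l) = enc_edge (start_edge b l).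
Proof. by rewrite /tree_start_edge tree_copy_enc. Qed.

Lemma tree_union_enc (A B : timed_automaton) :
  tree_union (enc_pair enc_ta enc_ta (A, B)) = enc_ta (union_ta A B).
Proof.
rewrite /tree_union /enc_pair /enc_ta [hd]lock [tl]lock /= -!lock /=.
rewrite !(tmap_enc _ (tree_copy_enc _)) !(tmap_enc _ (tree_rename_edge_enc _)).
by rewrite /enc_guard !tcat_enc !tree_copy_enc !tree_start_edge_enc.
Qed.

Lemma tree_computable_copy b (f : tree -> tree) :
  tree_computable f -> tree_computable (fun t => tree_copy b (f t)).
Proof.
move=> cf; apply: tree_computable_cons; first exact: tree_computable_const.
apply: tree_computable_cat; first exact: tree_computable_const.
exact: tree_computable_cat.
Qed.

Lemma tree_computable_map_copy b (f : tree -> tree) :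
  tree_computable f -> tree_computable (fun t => tmap (tree_copy b) (f t)).
Proof.
apply: (tree_computable_map (f := fun=> tree_copy b)).
by apply: tree_computable_copy; tree_comp.
Qed.

Lemma tree_computable_map_rename_edge b (f : tree -> tree) :
  tree_computable f -> tree_computable (fun t => tmap (tree_rename_edge b) (f t)).
Proof.
apply: (tree_computable_map (f := fun=> tree_rename_edge b)).
rewrite /tree_rename_edge; apply: tree_computable_cons.
  by apply: tree_computable_copy; tree_comp.
do 3!(apply: tree_computable_cons; first by tree_comp).
by apply: tree_computable_copy; tree_comp.
Qed.

Lemma tree_computable_start_edge b (f : tree -> tree) :
  tree_computable f -> tree_computable (fun t => tree_start_edge b (f t)).
Proof.
move=> cf; rewrite /tree_start_edge.
do 4!(apply: tree_computable_cons; first exact: tree_computable_const).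
exact: tree_computable_copy.
Qed.

Lemma tree_computable_union : tree_computable tree_union.
Proof.
rewrite /tree_union; repeat first
  [ exact: tree_computable_id | apply: tree_computable_const
  | apply: tree_computable_start_edge | apply: tree_computable_copy
  | apply: tree_computable_map_copy | apply: tree_computable_map_rename_edge
  | apply: tree_computable_cat | apply: tree_computable_hd
  | apply: tree_computable_tl | apply: tree_computable_cons ].
Qed.

Lemma timed_language_inclusion_reduces (R : realType) :
  many_one_reduces (timed_language_inclusion R) (weak_opacity R).
Proof.
exists (fun AB => union_ta AB.1 AB.2); split.
  by apply: computable_of_tree tree_computable_union _ => -[A B]; exact: tree_union_enc.
by move=> [A B]; rewrite /= /weakly_opaque union_PrivTr union_PubTr.
Qed.

Theorem theorem4p7 (R : realType) :
  many_one_reduces (timed_language_inclusion R) (weak_opacity R) /\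
  many_one_reduces (weak_opacity R) (timed_language_inclusion R).
Proof.
split; [exact: timed_language_inclusion_reduces | exact: weak_opacity_reduces].
Qed.
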